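(* Assume that (A2) $\lim_{\eta\to0}\mathbb{P}^x\{\tau_{\mathcal O}<\eta\}=0$ uniformly in $x$ from compact subsets of $\mathcal O$, and (A3) $(X(t))$ is strongly Feller, i.e. $x\mapsto\mathbb{E}^x\{h(X(t))\}$ is continuous for every measurable bounded $h:E\to\mathbb{R}$ and every $t>0$. Then the mapping $x\mapsto P^{\tau_{\mathcal O}}_th(x):=\mathbb{E}^x\{1_{\{t<\tau_{\mathcal O}\}}h(X(t))\}$ is continuous on $E\setminus\partial\mathcal O$ for every bounded measurable $h:E\to\mathbb{R}$ and every $t>0$. If additionally (A4) $\lim_{x\to\partial\mathcal O,\ x\in\mathcal O}\mathbb{P}^x\{\tau_{\mathcal O}>\eta\}=0$ for every $\eta>0$ (the limit being taken as $x\in\mathcal O$ tends to any point of $\partial\mathcal O$), then for every $t>0$ the operator $P^{\tau_{\mathcal O}}_t$ maps the space of bounded measurable functions into the space of continuous bounded functions on $E$; as a result, $P^{\tau_{\mathcal O}}_t$ maps the space of continuous bounded functions into itself.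
   Context: Setting. $E$ is a locally compact separable space with a metric $\rho$ for which every closed ball is compact. $(X(t))_{t\ge0}$ is a standard Markov process on $E$ (strong Markov, càdlàg, quasi-left-continuous, with complete right-continuous filtration) with laws $\mathbb{P}^x$ and expectations $\mathbb{E}^x$, $x\in E$. It is weakly Feller: $P_t\mathcal C_0\subseteq\mathcal C_0$, where $P_th(x)=\mathbb{E}^x\{h(X(t))\}$ and $\mathcal C_0$ is the space of continuous bounded functions $E\to\mathbb{R}$ vanishing at infinity. $\mathcal O\subset E$ is an open set and $\tau_{\mathcal O}=\inf\{t\ge0: X(t)\notin\mathcal O\}$. *)

(* Defs.v *)
From HB Require Import structures.
From mathcomp Require Import all_boot all_order all_algebra.
From mathcomp Require Import all_classical all_reals all_analysis.
(* Provides the Borel structure of \bar R, which all_analysis does not export. *)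
From mathcomp Require Import measurable_realfun.

Set Implicit Arguments.
Unset Strict Implicit.
Unset Printing Implicit Defensive.

Import Order.TTheory GRing.Theory Num.Theory.
Import numFieldNormedType.Exports.

Local Open Scope classical_set_scope.
Local Open Scope ring_scope.

(* The library's measurable types are pointed, so a Borel measurableType on a
   metric space needs a distinguished point; it plays no mathematical role. *)
#[short(type="pointedMetricType")]
HB.structure Definition PointedMetric (K : numDomainType) :=
  { M of Pointed M & Metric K M }.

Notation borel E := (g_sigma_algebraType (@open E)).

(* The library's [closed_ball] is the closure of the open ball, which may be
   strictly smaller than this set. *)
Definition mclosed_ball (R : realType) (E : metricType R) (x : E) (r : R) :
  set E := [set y | mdist x y <= r].

Definition separable (E : topologicalType) :=
  exists2 D : set E, countable D & dense D.

Definition boundary (E : topologicalType) (A : set E) : set E :=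
  closure A `\` interior A.

Section function_spaces.
Context {R : realType} {E : pointedMetricType R}.
Implicit Type h : E -> R.

Definition bounded_measurable h :=
  bounded_fun h /\ measurable_fun [set: borel E] (h : borel E -> R).

Definition bounded_continuous h := bounded_fun h /\ continuous h.

Definition vanishes_at_infinity h :=
  forall e : R, 0 < e ->
    exists2 K : set E, compact K & forall x, ~ K x -> `|h x| < e.

Definition C0 h := bounded_continuous h /\ vanishes_at_infinity h.

End function_spaces.

Section processes.
Context {R : realType} {E : pointedMetricType R} {d : measure_display}
  {Omega : measurableType d}.
(* Times are elements of R; only their values for t >= 0 matter. *)
Variables (P : E -> probability Omega R) (X : R -> Omega -> E)
  (F : R -> set (set Omega)).

Definition transition (t : R) (h : E -> R) (x : E) : R :=
  fine ('E_(P x)[fun w => h (X t w)])%E.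

Definition exit_time (O : set E) (w : Omega) : \bar R :=
  ereal_inf [set t%:E | t in [set t : R | 0 <= t /\ ~ O (X t w)]].

Definition killed_transition (O : set E) (t : R) (h : E -> R) (x : E) : R :=
  fine ('E_(P x)[(fun w =>
    \1_[set w' | (t%:E < exit_time O w')%E] w * h (X t w))%R])%E.

Definition stopping_time (T : Omega -> \bar R) :=
  (forall w, (0 <= T w)%E) /\
  (forall t, 0 <= t -> F t [set w | (T w <= t%:E)%E]).

Definition stopped_events (T : Omega -> \bar R) : set (set Omega) :=
  [set A | measurable A /\
     forall t, 0 <= t -> F t (A `&` [set w | (T w <= t%:E)%E])].

Definition raw_events : set (set Omega) :=
  <<s [set A | exists t (B : set (borel E)),
         [/\ 0 <= t, measurable B & A = X t @^-1` B]] >>.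

Definition filtration :=
  [/\ forall t, 0 <= t -> sigma_algebra [set: Omega] (F t),
      forall t, 0 <= t -> F t `<=` measurable
    & forall s t, 0 <= s -> s <= t -> F s `<=` F t].

Definition right_continuous_filtration :=
  forall t, 0 <= t -> \bigcap_(s in [set s | t < s]) F s `<=` F t.

(* Completeness with respect to the family of the laws
   P^mu = \int P^x mu(dx), mu ranging over all initial distributions. *)
Definition complete_filtration :=
  forall A : set Omega,
    (forall mu : probability (borel E) R,
       exists N, [/\ raw_events N, A `<=` N & (\int[mu]_x P x N = 0)%E]) ->
    F 0 A.

Definition adapted :=
  forall t (B : set (borel E)), 0 <= t -> measurable B -> F t (X t @^-1` B).

Definition cadlag :=
  forall w,
    (forall t, 0 <= t -> X s w @[s --> t^'+] --> X t w) /\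
    (forall t, 0 < t -> exists y : E, X s w @[s --> t^'-] --> y).

(* E^x[f(X(T + s)) | F_T] = E^{X(T)}[f(X(s))] on {T < oo}, spelled out by
   integrating over the events of F_T. *)
Definition strong_Markov :=
  forall (x : E) (T : Omega -> \bar R) (A : set Omega) (s : R) (f : E -> R),
    stopping_time T -> stopped_events T A -> 0 <= s -> bounded_measurable f ->
    \int[P x]_(w in A `&` [set w | (T w < +oo)%E]) f (X (fine (T w) + s) w) =
    \int[P x]_(w in A `&` [set w | (T w < +oo)%E])
      transition s f (X (fine (T w)) w).

Definition quasi_left_continuous :=
  forall (x : E) (T_ : nat -> Omega -> \bar R) (T : Omega -> \bar R),
    (forall n, stopping_time (T_ n)) ->
    (forall n w, (T_ n w <= T_ n.+1 w)%E) ->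
    (forall w, T_ n w @[n --> \oo] --> T w) ->
    {ae P x, forall w, (T w < +oo)%E ->
       X (fine (T_ n w)) w @[n --> \oo] --> X (fine (T w)) w}.

Record standard_process : Prop := {
  sp_filtration : filtration ;
  sp_right_continuous : right_continuous_filtration ;
  sp_complete : complete_filtration ;
  sp_adapted : adapted ;
  sp_measurable : forall t (B : set (borel E)), 0 <= t -> measurable B ->
    measurable_fun [set: borel E]
      (fun x : borel E => P x (X t @^-1` B)) ;
  sp_start : forall x, P x [set w | X 0 w = x] = 1%E ;
  sp_cadlag : cadlag ;
  sp_strong_Markov : strong_Markov ;
  sp_quasi_left_continuous : quasi_left_continuous }.

Definition weakly_Feller :=
  forall (t : R) (h : E -> R), 0 <= t -> C0 h -> C0 (transition t h).

Definition strongly_Feller :=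
  forall (t : R) (h : E -> R), 0 < t -> bounded_measurable h ->
    continuous (transition t h).

Definition no_immediate_exit (O : set E) :=
  forall K : set E, compact K -> K `<=` O ->
  forall e : R, 0 < e -> \forall eta \near 0^'+, forall x, K x ->
    (P x [set w | (exit_time O w < eta%:E)%E] < e%:E)%E.

Definition regular_boundary (O : set E) :=
  forall eta : R, 0 < eta -> forall y, boundary O y ->
    P x [set w | (eta%:E < exit_time O w)%E] @[x --> within O (nbhs y)]
      --> 0%E.

End processes.

(* Main.v *)
(* Let S be the exit time of O. For 0 < s < t, let g(x) be E^x[h(X(t - s))] on
   the event that the path stays in O during [0, t - s], left limits included.
   By the Markov property P_s g(x) is E^x[h(X(t))] on the event that the path
   stays in O during [s, t], so |P^S_t h(x) - P_s g(x)| <= sup|h| P^x(S <= s).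
   P_s g is continuous by the strong Feller property and the error tends to 0
   uniformly on compact subsets of O by (A2), whence continuity on O. Off O the
   killed semigroup vanishes, and (A4) makes it tend to 0 at the boundary since
   |P^S_t h(x)| <= sup|h| P^x(S > t).
   Two points need care. The strong Markov hypothesis only concerns one future
   time, so the events "X stays in the closed set C" are reached as limits of
   events on equally spaced grids, which one-step transitions handle by
   induction. And S is not obviously measurable: by quasi-left-continuity, up to
   a null event, staying in O during [0, t] means staying in one of the closed
   sets [inner O n], and completeness of the filtration does the rest. *)
Require Import Defs.
From HB Require Import structures.
From mathcomp Require Import all_boot all_order all_algebra.
From mathcomp Require Import all_classical all_reals all_analysis.
From mathcomp Require Import measurable_realfun.
From mathcomp Require Import ring lra.

Set Implicit Arguments.
Unset Strict Implicit.
Unset Printing Implicit Defensive.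

Import Order.TTheory GRing.Theory Num.Theory.
Import numFieldNormedType.Exports.

Local Open Scope classical_set_scope.
Local Open Scope ring_scope.

(* Essentially the points at distance at least 1/(n+1) from the complement of O;
   interiors appear because balls of a pseudometric space need not be open. *)
Definition inner {R : realType} {E : pseudoMetricType R} (O : set E) (n : nat) :
    set E :=
  ~` \bigcup_(y in ~` O) (ball y n.+1%:R^-1)°.

(** * Exhaustion of an open set by closed sets *)

Section inner.
Context {R : realType} {E : pseudoMetricType R}.
Implicit Types O : set E.

Lemma closed_inner O n : closed (inner O n).
Proof.
by apply: open_closedC; apply: bigcup_open => y _; exact: open_interior.
Qed.

Lemma inner_sub O n : inner O n `<=` O.
Proof.
move=> x; apply: contra_notP => Ox; exists x => //.
by apply: nbhsx_ballx; rewrite invr_gt0.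
Qed.

Lemma inner_mono O m n : (m <= n)%N -> inner O m `<=` inner O n.
Proof.
move=> mn; apply: subsetC => x [y Oy] yx; exists y => //.
apply: interiorS yx; apply: le_ball.
by rewrite lef_pV2 ?posrE// ler_nat.
Qed.

(** If the ball of radius [e] about [x] lies in [O], the triangle inequality keeps the ball of
    radius [e / 2] at distance from the complement. A whole neighbourhood is needed because limits
    of paths are tested against interiors. *)
Lemma inner_nbhs O x : open O -> O x -> exists n, nbhs x (inner O n).
Proof.
move=> oO Ox.
have /nbhs_ballP[e /= e0 xeO] : nbhs x O by apply: open_nbhs_nbhs.
have [n /andP[_ ne]] : exists n, true && (n.+1%:R^-1 < e / 2).
  have [n _ /(_ n (leqnn n))] :=
    near_infty_natSinv_lt (PosNum (divr_gt0 e0 (@ltr0Sn R 1))).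
  by exists n.
exists n; apply/nbhs_ballP; exists (e / 2) => /=; first by rewrite divr_gt0.
move=> z xz [y /= Oy /interior_subset yz]; apply: Oy; apply: xeO.
rewrite [e]splitr; apply: ball_triangle xz _; apply: ball_sym.
exact: le_ball (ltW ne) _ yz.
Qed.

End inner.

Lemma nonneg_dense (R : realType) : exists q : nat -> R,
  (forall n, 0 <= q n) /\
  forall a b, 0 <= a -> a < b -> exists n, a < q n < b.
Proof.
(* Absolute values of the rationals; codes that decode to no rational give 0. *)
exists (fun n => `|ratr (odflt 0 (unpickle n))|); split=> [//|a b a0 ab].
have [r] := rat_in_itvoo ab; rewrite in_itv /= => /andP[ar rb].
by exists (pickle r); rewrite pickleK /= ger0_norm ?ar// (le_trans a0 (ltW ar)).
Qed.

(** * Exit times of right-continuous paths *)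

Definition stays {R : realType} {E : pointedMetricType R} {Omega : Type}
  (X : R -> Omega -> E) (D : set E) (s t : R) : set Omega :=
  [set w | forall r, s <= r <= t -> D (X r w)].

Section paths.
Context {R : realType} {E : pointedMetricType R} {d : measure_display}
  {Omega : measurableType d}.
Variables (X : R -> Omega -> E).
Hypothesis X_right : forall w (t : R), 0 <= t -> X s w @[s --> t^'+] --> X t w.
Implicit Types (w : Omega) (t : R) (D C O : set E).

Lemma right_continuous_nbhs w t D : 0 <= t -> nbhs (X t w) D ->
  exists2 b, t < b & forall r, t <= r < b -> D (X r w).
Proof.
move=> t0 tD; have := X_right t0 tD.
rewrite /nbhs /= /at_right /within /= => /nbhs_ballP[e /= e0 H].
exists (t + e) => [|r /andP[]]; first by rewrite ltrDl.
rewrite le_eqVlt => /predU1P[<- _|tr rte]; first exact: nbhs_singleton.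
by apply: H => //=; rewrite /ball /= ltr_distlC; lra.
Qed.

Lemma exit_time_ge0 D w : (0 <= exit_time X D w)%E.
Proof. by apply: le_ereal_inf_tmp => _ [t [t0 _] <-]; rewrite lee_fin. Qed.

Lemma exit_time_le D w r : 0 <= r -> ~ D (X r w) -> (exit_time X D w <= r%:E)%E.
Proof. by move=> r0 Dr; apply: ereal_inf_lbound; exists r. Qed.

Lemma exit_time_ltP D w t : (exit_time X D w < t%:E)%E <->
  exists r, [/\ 0 <= r, r < t & ~ D (X r w)].
Proof.
split=> [|[r [r0 rt Dr]]].
  by move/ereal_inf_lt => [_ [r [r0 Dr] <-]]; rewrite lte_fin => rt; exists r.
by apply: le_lt_trans (exit_time_le r0 Dr) _; rewrite lte_fin.
Qed.

Lemma exit_time_mono D D' w : D `<=` D' ->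
  (exit_time X D w <= exit_time X D' w)%E.
Proof.
by move=> DD'; apply: ereal_inf_le_tmp => _ [t [t0 Dt] <-]; exists t => //;
  split=> // /DD'.
Qed.

(** Were [X t w] interior to [D], right continuity would keep the path in [D] for a while after [t],
    and the infimum would exceed [t]. *)
Lemma exit_time_not_interior D w t : exit_time X D w = t%:E -> ~ nbhs (X t w) D.
Proof.
move=> Dt; have t0 : 0 <= t by rewrite -lee_fin -Dt exit_time_ge0.
move=> /(right_continuous_nbhs t0)[b tb Db].
have : (exit_time X D w < b%:E)%E by rewrite Dt lte_fin.
move=> /exit_time_ltP[r [r0 rb Dr]]; apply: (Dr); apply: Db.
by rewrite rb andbT -lee_fin -Dt exit_time_le.
Qed.

(** Strictness comes from openness: a path in [O] at time [t] remains there a little longer. *)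
Lemma exit_time_gtE O t : open O -> 0 <= t ->
  [set w | (t%:E < exit_time X O w)%E] = stays X O 0 t.
Proof.
move=> oO t0; apply/seteqP; split=> w /=.
  move=> tO r /andP[r0 rt]; apply: contrapT => /(exit_time_le r0).
  by rewrite leNgt (le_lt_trans _ tO)// lee_fin.
move=> Ot.
have [|b tb Ob] := @right_continuous_nbhs w t O t0.
  by apply: open_nbhs_nbhs; split=> //; apply: Ot; rewrite t0 lexx.
apply: (@lt_le_trans _ _ b%:E); first by rewrite lte_fin.
rewrite leNgt; apply/negP => /exit_time_ltP[r [r0 rb]]; apply.
by have [rt|tr] := leP r t; [apply: Ot; rewrite r0|apply: Ob; rewrite (ltW tr)].
Qed.

End paths.

(** * Exit times from closed sets as stopping times, and a common null event *)

Lemma borel_closed (E : ptopologicalType) (C : set E) :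
  closed C -> measurable (C : set (borel E)).
Proof.
move=> cC; rewrite -[C]setCK; apply: measurableC.
by apply: sub_sigma_algebra; exact: closed_openC.
Qed.

Section process.
Context {R : realType} {E : pointedMetricType R} {d : measure_display}
  {Omega : measurableType d}.
Variables (P : E -> probability Omega R) (X : R -> Omega -> E)
  (F : R -> set (set Omega)).
Hypothesis X_standard : standard_process P X F.
Implicit Types (w : Omega) (t : R) (D C O : set E).

Lemma path_right_continuous w t : 0 <= t -> X s w @[s --> t^'+] --> X t w.
Proof. by move=> t0; have [+ _] := sp_cadlag X_standard w; exact. Qed.

Lemma path_nbhs w t D : 0 <= t -> nbhs (X t w) D ->
  exists2 b, t < b & forall r, t <= r < b -> D (X r w).
Proof. by apply: right_continuous_nbhs => *; exact: path_right_continuous. Qed.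

Lemma measurable_preimage t (B : set (borel E)) : 0 <= t -> measurable B ->
  measurable (X t @^-1` B).
Proof.
move=> t0 mB; have [_ Fm _] := sp_filtration X_standard.
exact: Fm (sp_adapted X_standard t0 mB).
Qed.

Lemma raw_events_measurable : raw_events X `<=` measurable.
Proof.
apply: smallest_sub; first exact: sigma_algebra_measurable.
by move=> _ [t [B [t0 mB ->]]]; exact: measurable_preimage.
Qed.

(** By right continuity, a path that is outside [C] before [t] is outside it at some time before [t]
    in a countable dense set. The sigma-algebra is arbitrary because both [F s] and the raw events
    are needed. *)
Lemma exit_time_lt_sigma (G : set (set Omega)) C t :
  sigma_algebra setT G -> closed C ->
  (forall r, 0 <= r -> r < t -> G (X r @^-1` ~` C)) ->
  G [set w | (exit_time X C w < t%:E)%E].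
Proof.
move=> sG cC GC; have [q [q0 qd]] := nonneg_dense R.
rewrite (_ : [set w | _] = \bigcup_(n in [set n | q n < t]) (X (q n) @^-1` ~` C)).
  have <- := sigma_algebra_id sG.
  rewrite -[X in X _]/(@measurable _ (g_sigma_algebraType G)).
  apply: bigcup_measurable => n qnt.
  by apply: sub_sigma_algebra; apply: GC.
apply/seteqP; split=> w /=; last first.
  by move=> [n qnt CX]; apply/exit_time_ltP; exists (q n).
move/exit_time_ltP => [r [r0 rt CX]].
have [|b rb Cb] := @path_nbhs w r (~` C) r0.
  by apply: open_nbhs_nbhs; split=> //; exact: closed_openC.
have [n /andP[rn]] : exists n, r < q n < Num.min b t.
  by apply: qd => //; rewrite lt_min rb.
by rewrite lt_min => /andP[nb nt]; exists n => //; apply: Cb; rewrite (ltW rn).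
Qed.

(** Right continuity of the filtration turns the strict inequalities of [exit_time_lt_sigma] into a
    weak one. *)
Lemma exit_time_stopping C : closed C -> stopping_time F (exit_time X C).
Proof.
move=> cC; split=> [w|t t0]; first exact: exit_time_ge0.
have [sF _ F_mono] := sp_filtration X_standard.
apply: (sp_right_continuous X_standard t0) => s /= ts.
(* These times decrease to [t], starting from [s]. *)
pose r (k : nat) := t + (s - t) / k.+1%:R.
have st0 : 0 < s - t by rewrite subr_gt0.
have s0 : 0 <= s by rewrite (le_trans t0 (ltW ts)).
have tr k : t < r k by rewrite ltrDl divr_gt0.
have rs k : r k <= s.
  by rewrite -lerBrDl ler_piMr// ?(ltW st0)// invf_le1// ler1n.
rewrite (_ : [set w | _] = \bigcap_k [set w | (exit_time X C w < (r k)%:E)%E]).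
  have <- := sigma_algebra_id (sF s s0).
  rewrite -[X in X _]/(@measurable _ (g_sigma_algebraType (F s))).
  apply: bigcapT_measurable => k; apply: sub_sigma_algebra.
  apply: exit_time_lt_sigma => [||r' r'0 r's]; [exact: sF|exact: cC|].
  apply: (F_mono r') => //; first exact: le_trans (ltW r's) (rs k).
  apply: sp_adapted X_standard _ _ r'0 _.
  by apply: sub_sigma_algebra; exact: closed_openC.
apply/seteqP; split=> w /= Hw.
  by move=> k _ /=; apply: le_lt_trans Hw _; rewrite lte_fin.
apply/lee_addgt0Pr => e e0.
have [n _ /(_ n (leqnn n)) ne] :=
  near_infty_natSinv_lt (PosNum (divr_gt0 e0 st0)).
apply: le_trans (ltW (Hw n I)) _; rewrite lee_fin lerD2l.
by rewrite -ler_pdivlMl// mulrC ltW.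
Qed.

(* With T_n the exit time of [inner O n] and T = sup T_n, quasi-left-continuity
   gives X(T_n) --> X(T) a.s., while X(T_n) is not interior to [inner O n]; so
   a.s. X(T) is not in O. The event "T < oo and X(T) in O" is rewritten with
   countable operations on raw events only, as completeness requires. *)
Lemma raw_null_event O : open O ->
  exists N, [/\ raw_events X N, forall x, P x N = 0%E &
    forall u, 0 <= u ->
      stays X O 0 u `\` \bigcup_n stays X (inner O n) 0 u `<=` N].
Proof.
move=> oO; have [q [q0 qd]] := nonneg_dense R.
pose T_ n := exit_time X (inner O n).
pose T w := ereal_sup (range (T_ ^~ w)).
have T_mono w : {homo T_ ^~ w : m n / (m <= n)%N >-> (m <= n)%E}.
  by move=> m n mn; apply: exit_time_mono; exact: inner_mono.
have T_le n w : (T_ n w <= T w)%E by apply: ereal_sup_ubound; exists n.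
have T_ge0 w : (0 <= T w)%E by apply: le_trans (T_le 0%N w); exact: exit_time_ge0.
(* [H s] lies between the events T < s and T <= s, and is built from raw events. *)
pose H s := \bigcap_n [set w | (T_ n w < s%:E)%E].
have H_T w s : H s w -> (T w <= s%:E)%E.
  by move=> Hs; apply: ge_ereal_sup => _ [n _ <-]; apply: ltW; exact: Hs.
have T_H w s : (T w < s%:E)%E -> H s w.
  by move=> Ts n _ /=; apply: le_lt_trans Ts.
have T_fin w s : (T w <= s%:E)%E -> exists2 tau, T w = tau%:E & 0 <= tau.
  have := T_ge0 w; case: (T w) => [tau| |] //=; rewrite ?leye_eq// lee_fin.
  by exists tau.
(* Membership forces T <= [q i] < [q j] and X in [inner O m] at all dense times strictly between T
   and [q j]; right continuity and closedness then put X(T) in [inner O m]. *)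
pose N := \bigcup_m \bigcup_i \bigcup_(j in [set j | q i < q j])
  (H (q i) `&` \bigcap_(k in [set k | q k < q j])
    (~` H (q k) `|` X (q k) @^-1` inner O m)).
have rN : raw_events X N.
  pose G := [set A | exists t (B : set (borel E)),
    [/\ 0 <= t, measurable B & A = X t @^-1` B]].
  rewrite -[X in X _]/(@measurable _ (g_sigma_algebraType G)).
  have mX t B : 0 <= t -> measurable (B : set (borel E)) ->
      @measurable _ (g_sigma_algebraType G) (X t @^-1` B).
    by move=> t0 mB; apply: sub_sigma_algebra; exists t, B.
  have mH s : @measurable _ (g_sigma_algebraType G) (H s).
    apply: bigcapT_measurable => n; apply: exit_time_lt_sigma.
    - exact: smallest_sigma_algebra.
    - exact: closed_inner.
    - move=> r r0 _; apply: mX => //.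
      by apply: measurableC; apply: borel_closed; exact: closed_inner.
  do 3![apply: bigcup_measurable => ? _]; apply: measurableI => //.
  apply: bigcap_measurableType => k _; apply: measurableU.
    exact: measurableC.
  by apply: mX => //; apply: borel_closed; exact: closed_inner.
exists N; split=> //.
  move=> x; apply: measure_negligible; first exact: raw_events_measurable.
  have := @sp_quasi_left_continuous _ _ _ _ _ _ _ X_standard x T_ T.
  move=> /(_ (fun n => exit_time_stopping (@closed_inner _ _ O n))).
  move=> /(_ (fun n w => T_mono w _ _ (leqnSn n))).
  move=> /(_ (fun w => ereal_nondecreasing_cvgn (T_mono w))).
  apply: negligibleS => w [m _ [i _ [j /= qij [Hi Hk]]]] /= QLC.
  have Ti := H_T _ _ Hi; have [tau Tw tau0] := T_fin _ _ Ti.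
  have tauj : tau < q j by rewrite (le_lt_trans _ qij)// -lee_fin -Tw.
  have Otau : O (X tau w).
    apply: (@inner_sub _ _ _ m); apply: contrapT => mX.
    have [|b taub mb] := @path_nbhs w tau (~` inner O m) tau0.
      apply: open_nbhs_nbhs; split=> //; apply: closed_openC.
      exact: closed_inner.
    have [k /andP[tauk]] : exists k, tau < q k < Num.min b (q j).
      by apply: qd => //; rewrite lt_min taub.
    rewrite lt_min => /andP[kb kj].
    have [|] := Hk _ kj; first by apply; apply: T_H; rewrite Tw lte_fin.
    by apply: mb; rewrite (ltW tauk).
  (* Quasi-left-continuity puts X(T_n) in the interior of [inner O m'] for large n, hence of
     [inner O n] once n >= m', against [exit_time_not_interior]. *)
  have [m' m'X] := inner_nbhs oO Otau.
  have := QLC; rewrite Tw ltry => /(_ isT)/=.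
  move: m'X => /nbhs_interior m'X.
  move=> /(_ _ m'X)[n0 _ /(_ (maxn n0 m') (leq_maxl _ _))] /=.
  set n := maxn n0 m'; rewrite -/(nbhs _ (inner O m')) => m'n.
  apply: (@exit_time_not_interior _ _ _ _ X _ (inner O n) w (fine (T_ n w))).
  - by move=> *; exact: path_right_continuous.
  - rewrite -/(T_ n w) fineK// ge0_fin_numE ?exit_time_ge0//.
    by apply: le_lt_trans (T_le n w) _; rewrite Tw ltry.
  - by apply: filterS m'n; apply: inner_mono; exact: leq_maxr.
(* A path in [O] up to [u] that leaves every [inner O n] by then has T <= [u], hence X(T) in [O];
   [inner_nbhs] and right continuity supply [m], [j] and [i]. *)
move=> u u0 w [Ou nOu].
have Tu : (T w <= u%:E)%E.
  apply: ge_ereal_sup => _ [n _ <-]; rewrite leNgt; apply/negP => uT.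
  apply: nOu; exists n => // r /andP[r0 ru]; apply: contrapT => /(exit_time_le r0).
  by rewrite leNgt (le_lt_trans _ uT)// lee_fin.
have [tau Tw tau0] := T_fin _ _ Tu.
have Otau : O (X tau w) by apply: Ou; rewrite tau0 -lee_fin -Tw.
have [m mtau] := inner_nbhs oO Otau.
have [b taub mb] := path_nbhs tau0 mtau.
have [j /andP[tauj jb]] := qd _ _ tau0 taub.
have [i /andP[taui ij]] := qd _ _ tau0 tauj.
exists m => //; exists i => //; exists j => //; split.
  by apply: T_H; rewrite Tw lte_fin.
move=> k /= kj; have [Hk|] := pselect (H (q k) w); [right|by left].
by apply: mb; rewrite (lt_trans kj jb) andbT -lee_fin -Tw; exact: H_T.
Qed.

End process.

(** * Integrals of bounded functions against a probability *)

Lemma bounded_funE (T : Type) (R : realType) (f : T -> R) :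
  bounded_fun f <-> exists2 M, 0 < M & forall x, `|f x| <= M.
Proof.
split=> [[M [_ fM]]|[M _ fM]].
  exists (`|M| + 1); first by rewrite ltr_wpDl.
  by move=> x; apply: fM => //; rewrite ltr_pwDr// ler_norm.
exists M; split; first exact: num_real.
by move=> N MN x _; apply: le_trans (fM x) (ltW MN).
Qed.

Section bounded_integrals.
Context {R : realType} {d : measure_display} {T : measurableType d}.
Variable (mu : probability T R).
Implicit Types (f : T -> R) (A B D Z : set T) (M : R).

Lemma integrable_bounded f D M : measurable D -> measurable_fun setT f ->
  (forall w, `|f w| <= M) -> mu.-integrable D (EFin \o f).
Proof.
move=> mD mf fM; apply: measurable_bounded_integrable => //.
- by rewrite (le_lt_trans (probability_le1 mu mD))// ltry.
- exact: measurable_funTS.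
- exists M; split; first exact: num_real.
  by move=> N MN x _; apply: le_trans (fM x) (ltW MN).
Qed.

Lemma Rintegral_indic A M : measurable A ->
  \int[mu]_w (M * \1_A w) = M * fine (mu A).
Proof.
move=> mA; rewrite RintegralZl//.
  by rewrite /Rintegral integral_indic// setIT.
apply: (@integrable_bounded _ _ 1) => //.
by move=> w; rewrite indicE; case: (_ \in _); rewrite ?normr1 ?normr0 ?lexx.
Qed.

(** The integrands [f \_ A] and [f \_ B] agree off [Z] and differ by at most [M] on it. *)
Lemma Rintegral_symdiff A B Z f M :
  measurable A -> measurable B -> measurable Z -> measurable_fun setT f ->
  (forall w, `|f w| <= M) -> (forall w, ~ Z w -> (A w <-> B w)) ->
  `|\int[mu]_(w in A) f w - \int[mu]_(w in B) f w| <= M * fine (mu Z).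
Proof.
move=> mA mB mZ mf fM AB.
have M0 : 0 <= M by apply: le_trans (fM point).
have mr D : measurable D -> measurable_fun setT (f \_ D).
  by move=> mD; move: (mf) => /(measurable_funTS (D:=D)) /(measurable_restrictT f mD).
have fr D w : `|(f \_ D) w| <= M.
  by rewrite patchE; case: ifP => // _; rewrite normr0.
have ir D : measurable D -> mu.-integrable setT (EFin \o (f \_ D)).
  by move=> mD; apply: (@integrable_bounded _ _ M) => //; exact: mr.
rewrite Rintegral_mkcond [X in _ - X]Rintegral_mkcond -RintegralB//; last 2 first.
  exact: ir.
  exact: ir.
have mAB : measurable_fun setT (fun w => (f \_ A) w - (f \_ B) w).
  by apply: measurable_funB; exact: mr.
have fAB w : `|(f \_ A) w - (f \_ B) w| <= M * \1_Z w.
  rewrite indicE; have [Zw|] := pselect (Z w).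
    rewrite mem_set// mulr1 !patchE.
    by do 2!case: ifP; rewrite ?subrr ?sub0r ?subr0 ?normrN ?normr0.
  move=> nZ; rewrite memNset// mulr0 !patchE.
  have -> : (w \in A) = (w \in B).
    by apply/idP/idP; rewrite !inE => ?; apply/(AB _ nZ).
  by rewrite subrr normr0.
have MZ w : `|M * \1_Z w| <= M.
  rewrite indicE; case: (_ \in _); rewrite ?mulr1 ?mulr0 ?normr0//.
  by rewrite ger0_norm.
have iAB : mu.-integrable setT (EFin \o (fun w => (f \_ A) w - (f \_ B) w)).
  apply: (@integrable_bounded _ _ M) => // w.
  by apply: le_trans (fAB w) _; apply: le_trans (MZ w); exact: ler_norm.
have iZ : mu.-integrable setT (EFin \o (fun w => M * \1_Z w)).
  apply: (@integrable_bounded _ _ M) => //.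
  by apply: measurable_funM => //; exact: measurable_indic.
apply: le_trans (le_normr_Rintegral _ iAB) _ => //.
rewrite -Rintegral_indic//; apply: le_Rintegral => //.
exact: (integrable_norm iAB).
Qed.

Lemma Rintegral_bounded D f M : measurable D -> measurable_fun setT f ->
  (forall w, `|f w| <= M) -> `|\int[mu]_(w in D) f w| <= M * fine (mu D).
Proof.
move=> mD mf fM; rewrite -[X in `|X|]subr0 -(Rintegral_set0 mu f).
by apply: Rintegral_symdiff fM _ => // w; split.
Qed.

Lemma Rintegral_cvg_bounded (f_ : nat -> T -> R) f M :
  (forall n, measurable_fun setT (f_ n)) -> (forall n w, `|f_ n w| <= M) ->
  (forall w, f_ n w @[n --> \oo] --> f w) ->
  \int[mu]_w f_ n w @[n --> \oo] --> \int[mu]_w f w.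
Proof.
move=> mf_ f_M f_f.
have fM w : `|f w| <= M.
  rewrite -(cvg_lim (@Rhausdorff R) (cvg_norm (f_f w))).
  apply: limr_le; last exact: nearW.
  by apply/cvg_ex; exists `|f w|; exact: cvg_norm.
have mf : measurable_fun setT f by apply: (measurable_fun_cvg mf_) => w _.
apply: (@fine_cvg _ _ _ _ (fun n => \int[mu]_w (f_ n w)%:E)%E).
rewrite fineK; last first.
  by apply: integrable_fin_num => //; exact: (@integrable_bounded _ _ M).
apply: (@dominated_cvg _ _ _ mu setT measurableT _ _ (cst M%:E)) => //.
- by move=> n; apply/measurable_EFinP; exact: mf_.
- by move=> w _; apply: cvg_EFin; [exact: nearW|exact: f_f].
- apply: (@integrable_bounded (cst M) _ `|M|) => //.
- by move=> n w _; rewrite lee_fin.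
Qed.

Lemma Rintegral_cvg_set (D_ : nat -> set T) D f M :
  (forall n, measurable (D_ n)) -> measurable_fun setT f ->
  (forall w, `|f w| <= M) ->
  (forall w, \forall n \near \oo, D_ n w <-> D w) ->
  \int[mu]_(w in D_ n) f w @[n --> \oo] --> \int[mu]_(w in D) f w.
Proof.
move=> mD mf fM D_D; rewrite Rintegral_mkcond.
under eq_cvg do rewrite Rintegral_mkcond.
apply: (@Rintegral_cvg_bounded _ _ M) => [n|n w|w].
- by move: (mf) => /(measurable_funTS (D:=D_ n)) /(measurable_restrictT f (mD n)).
- rewrite patchE; case: ifP => // _; rewrite normr0.
  exact: le_trans (fM w).
- apply: cvg_near_cst; apply: filterS (D_D w) => n DD.
  rewrite !patchE; suff -> : (w \in D_ n) = (w \in D) by [].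
  by apply/idP/idP; rewrite !inE => ?; apply/DD.
Qed.
End bounded_integrals.

Lemma borel_continuous {R : realType} (E : pointedMetricType R) (h : E -> R) :
  continuous h -> measurable_fun [set: borel E] (h : borel E -> R).
Proof.
move=> /continuousP hc.
apply: (measurability _ (RGenOpens.measurableE R)) => _ [_ [a [b ->]] <-].
by rewrite setTI; apply: sub_sigma_algebra; apply: hc; exact: interval_open.
Qed.

(** * The Markov property on grids of times and its limits *)

Section markov.
Context {R : realType} {E : pointedMetricType R} {d : measure_display}
  {Omega : measurableType d}.
Variables (P : E -> probability Omega R) (X : R -> Omega -> E)
  (F : R -> set (set Omega)).
Hypothesis X_standard : standard_process P X F.
Hypothesis X_Feller : strongly_Feller P X.
Implicit Types (w : Omega) (t : R) (D C O : set E) (h : E -> R).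

Lemma measurable_state h t : bounded_measurable h -> 0 <= t ->
  measurable_fun setT (fun w => h (X t w)).
Proof.
move=> [_ mh] t0.
have mX : measurable_fun setT (X t : Omega -> borel E).
  by move=> _ B mB; rewrite setTI; exact: (measurable_preimage X_standard).
exact: (measurableT_comp mh mX).
Qed.

Lemma transitionE t h x : transition P X t h x = \int[P x]_w h (X t w).
Proof. by rewrite /transition unlock. Qed.

(** Measurability comes from the strong Feller property, as continuous functions are Borel; hence
    [t] is positive. *)
Lemma transition_bounded_measurable t h : 0 < t -> bounded_measurable h ->
  bounded_measurable (transition P X t h).
Proof.
move=> t0 mh; split; last exact: borel_continuous (X_Feller t0 mh).
have [/bounded_funE[M M0 hM] _] := mh.
apply/bounded_funE; exists M => // x; rewrite transitionE.
have := Rintegral_bounded (P x) measurableT (measurable_state mh (ltW t0))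
  (fun w => hM _).
by rewrite probability_setT mulr1.
Qed.

Lemma restrict_bounded_measurable C h : measurable (C : set (borel E)) ->
  bounded_measurable h -> bounded_measurable (h \_ C).
Proof.
move=> mC [/bounded_funE[M M0 hM] mh]; split.
  apply/bounded_funE; exists M => // x; rewrite patchE; case: ifP => // _.
  by rewrite normr0 ltW.
apply/(measurable_restrictT (h : borel E -> R) mC).
exact: measurable_funTS.
Qed.

(** The strong Markov property at the constant time [s]. *)
Lemma simple_Markov x A s t h : F s A -> 0 <= s -> 0 <= t ->
  bounded_measurable h ->
  \int[P x]_(w in A) h (X (s + t) w) =
  \int[P x]_(w in A) transition P X t h (X s w).
Proof.
move=> FA s0 t0 mh; have [sF Fm F_mono] := sp_filtration X_standard.
have F01 u (b : bool) : 0 <= u -> F u [set _ | b].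
  move=> u0; rewrite -(sigma_algebra_id (sF u u0)).
  rewrite -[X in X _]/(@measurable _ (g_sigma_algebraType (F u))).
  case: b; [rewrite (_ : [set _ | _] = setT)|rewrite (_ : [set _ | _] = set0)] => //.
    by apply/seteqP; split.
  by apply/seteqP; split.
have := @sp_strong_Markov _ _ _ _ _ _ _ X_standard x (cst s%:E) A t h.
rewrite /= (_ : [set w | _] = setT); last by apply/seteqP; split=> // w _; exact: ltry.
rewrite setIT; apply => //.
- by split=> [w|u u0]; [rewrite lee_fin|exact: F01].
- split=> [|u u0]; first exact: Fm FA.
  rewrite /= lee_fin; case: leP => su.
    rewrite (_ : [set w | _] = setT); last by apply/seteqP; split.
    by rewrite setIT; exact: F_mono FA.
  rewrite (_ : [set w | _] = set0); last by apply/seteqP; split.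
  by rewrite setI0; have := F01 u false u0;
   rewrite (_ : [set w | _] = set0)//; apply/seteqP; split.
Qed.

(** Time [s] itself is not tested, so that each level corresponds to one transition, as in
    [backward]. *)
Fixpoint grid C (delta : R) (k : nat) (s : R) : set Omega :=
  if k is k'.+1 then X (s + delta) @^-1` C `&` grid C delta k' (s + delta)
  else setT.

Lemma gridP C delta k s w : grid C delta k s w <->
  forall j, (j < k)%N -> C (X (s + j.+1%:R * delta) w).
Proof.
elim: k s => [|k IH] s /=; first by split.
have shift j : s + delta + j.+1%:R * delta = s + j.+2%:R * delta.
  by rewrite -(@natr1 _ j.+1); ring.
split=> [[Cs /IH Ck] [_|j jk]|Ck].
- by rewrite mul1r.
- by rewrite -shift; exact: Ck.
- split; first by have := Ck 0%N isT; rewrite mul1r.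
  by apply/IH => j jk; rewrite shift; exact: Ck.
Qed.

Lemma measurable_grid C delta k s : measurable (C : set (borel E)) ->
  0 <= delta -> 0 <= s -> measurable (grid C delta k s).
Proof.
move=> mC d0; elim: k s => [|k IH] s s0 /=; first exact: measurableT.
have sd0 : 0 <= s + delta by exact: addr_ge0.
by apply: measurableI; [exact: (measurable_preimage X_standard sd0 mC)|exact: IH].
Qed.

(** This is (P_delta 1_C)^k h, the semigroup of the chain sampled at step [delta] and killed outside
    [C]. *)
Fixpoint backward C (delta : R) (h : E -> R) (k : nat) : E -> R :=
  if k is k'.+1 then transition P X delta (backward C delta h k' \_ C) else h.

Lemma backward_bounded_measurable C delta h k :
  measurable (C : set (borel E)) ->
  0 < delta -> bounded_measurable h -> bounded_measurable (backward C delta h k).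
Proof.
move=> mC d0 mh; elim: k => //= k IH.
by apply: transition_bounded_measurable => //; exact: restrict_bounded_measurable.
Qed.

(** After one Markov step, the condition that X(s + delta) is in [C] moves from the integrand into
    the event, which then belongs to [F (s + delta)]. The induction therefore runs over all [A]. *)
Lemma grid_Markov C delta h k x A s : measurable (C : set (borel E)) ->
  0 < delta -> bounded_measurable h -> 0 <= s -> F s A ->
  \int[P x]_(w in A `&` grid C delta k s) h (X (s + k%:R * delta) w) =
  \int[P x]_(w in A) backward C delta h k (X s w).
Proof.
move=> mC d0 mh; elim: k s A => [|k IH] s A s0 FA /=.
  by rewrite setIT mul0r addr0.
have [sF _ F_mono] := sp_filtration X_standard.
have sd0 : 0 <= s + delta by rewrite addr_ge0// ltW.
have d1 := ltW d0; rewrite -simple_Markov//; last first.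
  by apply: restrict_bounded_measurable => //; exact: backward_bounded_measurable.
rewrite setIA (_ : s + _ = (s + delta) + k%:R * delta); last first.
  by rewrite -natr1; ring.
rewrite IH// ?Rintegral_mkcondr//.
rewrite -(sigma_algebra_id (sF _ sd0)).
apply: (@measurableI _ (g_sigma_algebraType (F (s + delta)))).
  by apply: sub_sigma_algebra; apply: F_mono FA => //; rewrite lerDl ltW.
by apply: sub_sigma_algebra; exact: sp_adapted X_standard _ _ sd0 mC.
Qed.

(* The event [D s] is understood as the shift by [s] of the event [D 0]. *)
Definition Markov_event (h : E -> R) (t : R) (D : R -> set Omega) :=
  (forall s, 0 <= s -> measurable (D s)) /\
  exists2 g, bounded_measurable g & forall s x, 0 <= s ->
    \int[P x]_(w in D s) h (X (s + t) w) = \int[P x]_w g (X s w).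

Lemma integral_start g x : bounded_measurable g ->
  \int[P x]_w g (X 0 w) = g x.
Proof.
move=> mg; have mA : measurable (X 0 @^-1` [set x]).
  apply: (measurable_preimage X_standard) => //; apply: borel_closed.
  exact/accessible_closed_set1/hausdorff_accessible/metric_hausdorff.
transitivity (\int[P x]_w (cst (g x) w)).
  congr fine; apply: ae_eq_integral => //.
  - by apply/measurable_EFinP; exact: measurable_state.
  - by apply/measurable_EFinP; exact: measurable_cst.
  - have : \forall w \ae P x, X 0 w = x.
      exists (~` (X 0 @^-1` [set x])); split=> //; first exact: measurableC.
      by rewrite probability_setC// (sp_start X_standard x) subee.
    by apply: filterS => w /= -> _.
by rewrite Rintegral_cst// [X in fine X](@probability_setT _ _ _ (P x)) mulr1.
Qed.

Lemma grid_Markov_event C delta h k : measurable (C : set (borel E)) ->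
  0 < delta -> bounded_measurable h ->
  Markov_event h (k%:R * delta) (grid C delta k).
Proof.
move=> mC d0 mh; split=> [s s0|]; first exact: measurable_grid (ltW d0) s0.
exists (backward C delta h k); first exact: backward_bounded_measurable.
move=> s x s0; rewrite -grid_Markov ?setTI//.
have [sF _ _] := sp_filtration X_standard.
by rewrite -(sigma_algebra_id (sF s s0));
  exact: (@measurableT _ (g_sigma_algebraType (F s))).
Qed.

(** At s = 0, [integral_start] identifies each witness with the integral [g_ n]. Hence the witnesses
    converge pointwise under the common bound [M], and dominated convergence passes to the limit on
    both sides. *)
Lemma Markov_event_limit h t (D_ : nat -> R -> set Omega) (D : R -> set Omega) :
  0 <= t -> bounded_measurable h -> (forall n, Markov_event h t (D_ n)) ->
  (forall s w, 0 <= s -> \forall n \near \oo, D_ n s w <-> D s w) ->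
  Markov_event h t D.
Proof.
move=> t0 mh MD DD; have [/bounded_funE[M M0 hM] _] := mh.
have mD_ n s : 0 <= s -> measurable (D_ n s) by apply: (MD n).1.
have mD s : 0 <= s -> measurable (D s).
  (* Eventual agreement makes [D s] the lower limit of the sets [D_ n s]. *)
  move=> s0; rewrite (_ : D s = \bigcup_N \bigcap_(n in [set n | (N <= n)%N]) D_ n s).
    by apply: bigcup_measurable => N _; apply: bigcap_measurableType => n _; exact: mD_.
  apply/seteqP; split=> w.
    by have [N _ DN] := DD s w s0 => Dw; exists N => // n /= Nn; apply/(DN n Nn).
  have [N _ DN] := DD s w s0 => -[N' _ D'].
  apply/(DN (maxn N N') (leq_maxl _ _)); apply: D'; exact: leq_maxr.
have hX s w : `|h (X s w)| <= M by [].
have mhX s : 0 <= s -> measurable_fun setT (fun w => h (X (s + t) w)).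
  by move=> s0; apply: measurable_state => //; exact: addr_ge0.
have cvgD s x : 0 <= s ->
    \int[P x]_(w in D_ n s) h (X (s + t) w) @[n --> \oo] -->
    \int[P x]_(w in D s) h (X (s + t) w).
  move=> s0; apply: (@Rintegral_cvg_set _ _ _ _ _ _ _ M) => //.
  - by move=> n; exact: mD_.
  - exact: mhX.
  - by move=> w; exact: DD.
split=> //.
pose g_ n x := \int[P x]_(w in D_ n 0) h (X (0 + t) w).
pose g x := \int[P x]_(w in D 0) h (X (0 + t) w).
have bound A x : measurable A -> `|\int[P x]_(w in A) h (X (0 + t) w)| <= M.
  move=> mA; have := Rintegral_bounded (P x) mA (mhX 0 (lexx _)) (fun w => hM _).
  move=> /le_trans; apply; rewrite ler_piMr// ?(ltW M0)//.
  rewrite -lee_fin fineK ?fin_num_measure//; exact: probability_le1.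
have g_P n s x : 0 <= s ->
    \int[P x]_(w in D_ n s) h (X (s + t) w) = \int[P x]_w g_ n (X s w).
  move=> s0; have [_ [f mf fP]] := MD n.
  rewrite fP//; apply: eq_Rintegral => w _.
  by rewrite /g_ fP// integral_start.
have mg_ n : bounded_measurable (g_ n).
  have [_ [f mf fP]] := MD n.
  rewrite (_ : g_ n = f)//; apply/funext => x.
  by rewrite /g_ fP// integral_start.
have g_g x : g_ n x @[n --> \oo] --> g x by exact: cvgD.
have mg : bounded_measurable g.
  split; first by apply/bounded_funE; exists M => // x; exact/bound/mD.
  apply: (@measurable_fun_cvg _ (borel E) R setT g_) => [n|x _]; last exact: g_g.
  by have [] := mg_ n.
exists g => // s x s0.
apply: (@cvg_unique _ (@Rhausdorff R)
  ((fun n => \int[P x]_(w in D_ n s) h (X (s + t) w)) @ \oo)).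
  exact: cvgD.
rewrite (_ : (fun n => _) = (fun n => \int[P x]_w g_ n (X s w))); last first.
  by apply/funext => n; exact: g_P.
apply: (@Rintegral_cvg_bounded _ _ _ _ _ _ M) => [n|n w|w].
- exact: measurable_state.
- exact/bound/mD_.
- exact: g_g.
Qed.

End markov.

(** * Staying events and approximation of the killed semigroup *)

Lemma half_powers_lt (R : realType) (u e : R) : 0 < u -> 0 < e ->
  exists N, u / 2 ^+ N < e.
Proof.
move=> u0 e0; exists (Num.truncn (u / e)).+1.
rewrite ltr_pdivrMr ?exprn_gt0// mulrC -ltr_pdivrMr//.
have /andP[_ /lt_trans->//] := truncn_itv (divr_ge0 (ltW u0) (ltW e0)).
by rewrite -natrX ltr_nat ltn_expl.
Qed.

Section killed.
Context {R : realType} {E : pointedMetricType R} {d : measure_display}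
  {Omega : measurableType d}.
Variables (P : E -> probability Omega R) (X : R -> Omega -> E)
  (F : R -> set (set Omega)).
Hypothesis X_standard : standard_process P X F.
Hypothesis X_Feller : strongly_Feller P X.
Implicit Types (w : Omega) (s t u M : R) (D C O : set E) (h : E -> R).

Lemma grid_stays C u s w : closed C -> 0 < u -> 0 <= s ->
  \forall n \near \oo,
    grid X C (u / 2 ^+ n) (2 ^ n) s w <-> stays X C s (s + u) w.
Proof.
move=> cC u0 s0.
have [Cw|nCw] := pselect (stays X C s (s + u) w).
  apply: nearW => n; split=> // _; apply/gridP => j jn; apply: Cw.
  rewrite lerDl mulr_ge0 ?divr_ge0 ?exprn_ge0 ?(ltW u0)//= lerD2l.
  rewrite mulrCA ler_piMr ?(ltW u0)// ler_pdivrMr ?exprn_gt0// mul1r.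
  by rewrite -natrX ler_nat.
(* Dyadic grids are nested, so a point of the grid of level [N] at which the path is outside [C]
   spoils all finer grids. *)
suff [N [j jN CX]] : exists N, exists2 j, (j < 2 ^ N)%N &
    ~ C (X (s + j.+1%:R * (u / 2 ^+ N)) w).
  exists N => // n /= /subnKC <-; move: (n - N)%N => {n} k.
  split=> // /gridP Cn; exfalso; apply: CX.
  (* Index [j] stands for the grid time of rank [j.+1], whose rank at level [N + k] is
     [j.+1 * 2 ^ k]; hence the predecessor. *)
  have /Cn : ((j.+1 * 2 ^ k).-1 < 2 ^ (N + k))%N.
    by rewrite prednK ?muln_gt0 ?expn_gt0// expnD leq_mul2r jN orbT.
  rewrite prednK ?muln_gt0 ?expn_gt0//; congr (C (X (s + _) w)).
  by rewrite natrM natrX exprD; field; rewrite !expf_neq0.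
have [r /andP[sr rsu] Cr] : exists2 r, s <= r <= s + u & ~ C (X r w).
  apply: contrapT => H; apply: nCw => r rsu; apply: contrapT => Cr.
  by apply: H; exists r.
move: rsu; rewrite le_eqVlt => /predU1P[rE|rsu].
  (* The right endpoint [s + u] belongs to every grid, even the one with a single step. *)
  by exists 0%N, 0%N => //; rewrite expr0 divr1 mul1r -rE.
have [|b rb Cb] := @path_nbhs _ _ _ _ _ _ _ X_standard w r (~` C) (le_trans s0 sr).
  by apply: open_nbhs_nbhs; split=> //; exact: closed_openC.
(* The mesh is so fine that the first grid time after [r] falls before both [b] and [s + u]. *)
have [|N uN] := @half_powers_lt _ u (Num.min b (s + u) - r) u0.
  by rewrite subr_gt0 lt_min rb.
pose delta := u / 2 ^+ N; have d0 : 0 < delta by rewrite divr_gt0 ?exprn_gt0.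
pose j := Num.truncn ((r - s) / delta).
have /andP[jr rj] : j%:R <= (r - s) / delta < j.+1%:R.
  by apply: truncn_itv; rewrite divr_ge0 ?subr_ge0// ltW.
rewrite ler_pdivlMr// in jr; rewrite ltr_pdivrMr// in rj.
have := uN; rewrite ltrBrDr lt_min -/delta => /andP[ub us].
have jE : j.+1%:R * delta = j%:R * delta + delta by rewrite -natr1 mulrDl mul1r.
exists N, j; last by rewrite -/delta; apply: Cb; rewrite jE in rj *; lra.
rewrite -(ltr_nat R) natrX.
have : j%:R * delta < 2 ^+ N * delta.
  rewrite /delta [X in _ < X]mulrC divfK ?expf_neq0// -/delta; lra.
by rewrite ltr_pM2r.
Qed.

Lemma stays_Markov_event C u h : closed C -> 0 < u -> bounded_measurable h ->
  Markov_event P X h u (fun s => stays X C s (s + u)).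
Proof.
move=> cC u0 mh; apply: (Markov_event_limit X_standard (ltW u0) mh (D_ :=
  fun n => grid X C (u / 2 ^+ n) (2 ^ n))); last first.
  by move=> s w s0; exact: grid_stays.
move=> n; have -> : u = (2 ^ n)%:R * (u / 2 ^+ n).
  by rewrite natrX mulrC divfK// expf_neq0.
have -> : (2 ^ n)%:R * (u / 2 ^+ n) / 2 ^+ n = u / 2 ^+ n.
  by rewrite natrX [X in X / _]mulrC divfK// expf_neq0.
apply: (grid_Markov_event X_standard X_Feller) => //.
  exact: borel_closed.
by rewrite divr_gt0// exprn_gt0.
Qed.

(** The sets [inner O n] increase, so membership in the union eventually agrees with membership at
    level n: a second passage to the limit. *)
Lemma inner_Markov_event O u h : 0 < u -> bounded_measurable h ->
  Markov_event P X h u (fun s => \bigcup_n stays X (inner O n) s (s + u)).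
Proof.
move=> u0 mh; apply: (Markov_event_limit X_standard (ltW u0) mh (D_ :=
  fun n s => stays X (inner O n) s (s + u))).
  by move=> n; apply: stays_Markov_event => //; exact: closed_inner.
move=> s w s0; have [[N _ SN]|nS] := pselect
    ((\bigcup_n stays X (inner O n) s (s + u)) w).
  exists N => // n /= Nn; split=> _; first by exists N.
  by move=> r rsu; apply: inner_mono Nn _ (SN r rsu).
by apply: nearW => n; split=> // Sn; exists n.
Qed.

Lemma measurable_stays O t : open O -> 0 < t -> measurable (stays X O 0 t).
Proof.
move=> oO t0; have [N [rN N0 SN]] := raw_null_event X_standard oO.
have := SN t (ltW t0); set S := \bigcup_n _ => SBN.
have mS : measurable S.
  (* The zero function is a dummy that gives access to the measurability half of
     [inner_Markov_event]. *)
  have mh : bounded_measurable (cst 0 : E -> R).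
    split; last exact: measurable_cst.
    by apply/bounded_funE; exists 1 => // x; rewrite normr0.
  have [/(_ 0 (lexx _)) + _] := inner_Markov_event O t0 mh.
  by rewrite add0r.
have SO : S `<=` stays X O 0 t.
  by move=> w [n _ Sn] r rt; exact: inner_sub (Sn r rt).
rewrite -(setDUK SO); apply: measurableU => //.
(* What is left lies in a raw event null under every P^x, hence under every mixture; completeness
   puts it in [F 0]. *)
have [_ Fm _] := sp_filtration X_standard.
apply: (Fm 0) => //; apply: (sp_complete X_standard) => mu.
exists N; split=> //.
by rewrite (eq_integral (cst 0%E)) ?integral0// => x _; exact: N0.
Qed.

Lemma measurable_exit_time_lt O t : open O ->
  measurable [set w | (exit_time X O w < t%:E)%E].
Proof.
move=> oO; have [q [q0 qd]] := nonneg_dense R.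
rewrite (_ : [set w | _] =
    \bigcup_(n in [set n | 0 < q n < t]) ~` stays X O 0 (q n)).
  apply: bigcup_measurable => n /andP[qn0 _]; apply: measurableC.
  exact: measurable_stays.
have rc := @path_right_continuous _ _ _ _ _ _ _ X_standard.
apply/seteqP; split=> w /=.
  move=> /exit_time_ltP[r [r0 rt Or]]; have [n /andP[rq qt]] := qd r t r0 rt.
  exists n; first by rewrite /= (le_lt_trans r0 rq).
  by move=> Oq; apply: Or (Oq r _); rewrite r0 ltW.
move=> [n /= /andP[qn0 qnt]]; rewrite -exit_time_gtE//= => /negP.
by rewrite -leNgt => /le_lt_trans; apply; rewrite lte_fin.
Qed.

Lemma killed_transitionE O t h x : open O -> 0 <= t ->
  killed_transition P X O t h x = \int[P x]_(w in stays X O 0 t) h (X t w).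
Proof.
move=> oO t0; rewrite /killed_transition unlock Rintegral_mkcond.
rewrite exit_time_gtE//; last exact: path_right_continuous X_standard.
congr fine; apply: eq_integral => w _; congr EFin.
by rewrite indicE patchE; case: (_ \in _); rewrite ?mul1r ?mul0r.
Qed.

(** Off a null event and the event of leaving [O] by time [s], staying in [O] over [0, t] amounts to
    staying in some [inner O n] over [s, t], and the latter is a Markov event shifted by [s]. *)
Lemma killed_transition_approx O s t h M : open O -> 0 < s -> s < t ->
  bounded_measurable h -> (forall x, `|h x| <= M) ->
  exists2 g, bounded_measurable g & forall x,
    `|killed_transition P X O t h x - transition P X s g x|
    <= M * fine (P x (~` stays X O 0 s)).
Proof.
move=> oO s0 st mh hM; have t0 := lt_trans s0 st.
have [|mS [g mg gP]] := inner_Markov_event O _ mh (u := t - s).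
  by rewrite subr_gt0.
exists g => // x; rewrite transitionE -gP ?(ltW s0)// killed_transitionE ?(ltW t0)//.
rewrite subrKC.
have [N [rN N0 SN]] := raw_null_event X_standard oO.
have mN := raw_events_measurable X_standard rN.
rewrite -(measureU0 _ mN (N0 x)); last first.
  by apply: measurableC; exact: measurable_stays.
apply: Rintegral_symdiff.
- exact: measurable_stays.
- by have := mS s (ltW s0); rewrite subrKC.
- by apply: measurableU => //; apply: measurableC; exact: measurable_stays.
- by apply: (measurable_state X_standard) => //; exact: ltW.
- by move=> w; exact: hM.
- move=> w /not_orP[/contrapT Os Nw]; split=> [Ot|[n _ Sn] r /andP[r0 rt]].
    have [n _ Sn] : (\bigcup_n stays X (inner O n) 0 t) w.
      apply: contrapT => nS; apply: Nw; apply: (SN t (ltW t0)); split=> //.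
    by exists n => // r /andP[sr rt]; apply: Sn; rewrite (le_trans (ltW s0) sr).
  have [rs|sr] := leP r s; first by apply: Os; rewrite r0.
  by apply: inner_sub (Sn r _); rewrite (ltW sr).
Qed.

End killed.

(** * Continuity inside [O], outside its closure and at its boundary *)

Section continuity.
Context {R : realType} {E : pointedMetricType R} {d : measure_display}
  {Omega : measurableType d}.
Variables (P : E -> probability Omega R) (X : R -> Omega -> E)
  (F : R -> set (set Omega)).
Hypothesis X_standard : standard_process P X F.
Hypothesis X_Feller : strongly_Feller P X.
Implicit Types (w : Omega) (s t u M : R) (D C O : set E) (h : E -> R).

Lemma killed_transition_le O t h M x : open O -> 0 < t ->
  bounded_measurable h -> (forall y, `|h y| <= M) ->
  `|killed_transition P X O t h x| <=
  M * fine (P x [set w | (t%:E < exit_time X O w)%E]).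
Proof.
move=> oO t0 mh hM; rewrite (killed_transitionE X_standard)//; last exact: ltW.
rewrite exit_time_gtE ?(ltW t0)//; last exact: path_right_continuous X_standard.
apply: Rintegral_bounded => //; first exact: (measurable_stays X_standard X_Feller).
by apply: (measurable_state X_standard) => //; exact: ltW.
Qed.

Lemma killed_transition_bounded O t h : open O -> 0 < t ->
  bounded_measurable h -> bounded_fun (killed_transition P X O t h).
Proof.
move=> oO t0 mh; have [/bounded_funE[M M0 hM] _] := mh.
apply/bounded_funE; exists M => // x.
apply: le_trans (killed_transition_le _ oO t0 mh hM) _.
rewrite exit_time_gtE ?(ltW t0)//; last exact: path_right_continuous X_standard.
have mO := measurable_stays X_standard X_Feller oO t0.
rewrite ler_piMr ?(ltW M0)//.
by rewrite -lee_fin fineK ?fin_num_measure//; exact: probability_le1.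
Qed.

(** X(0) = x almost surely, so almost every path is outside [O] at time 0. *)
Lemma killed_transition_out O t h x : open O -> 0 < t ->
  bounded_measurable h -> ~ O x -> killed_transition P X O t h x = 0.
Proof.
move=> oO t0 mh Ox; have [/bounded_funE[M M0 hM] _] := mh.
apply/normr0_eq0/eqP; rewrite eq_le normr_ge0 andbT.
apply: le_trans (killed_transition_le _ oO t0 mh hM) _.
rewrite exit_time_gtE ?(ltW t0)//; last exact: path_right_continuous X_standard.
rewrite (_ : P x _ = 0%E) ?mulr0//.
have mx : measurable (X 0 @^-1` [set x]).
  apply: (measurable_preimage X_standard) => //; apply: borel_closed.
  exact/accessible_closed_set1/hausdorff_accessible/metric_hausdorff.
apply/eqP; rewrite eq_le measure_ge0 andbT.
apply: (@le_trans _ _ (P x (~` (X 0 @^-1` [set x])))).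
  apply: le_measure; rewrite ?inE.
  - exact: (measurable_stays X_standard X_Feller).
  - exact: measurableC.
  - move=> w Ow /= Xx; apply: Ox; rewrite -Xx; apply: Ow.
    by rewrite lexx ltW.
by rewrite probability_setC// (sp_start X_standard x) subee.
Qed.

Lemma killed_transition_continuous_in O t h x :
  (forall (y : E) (r : R), compact (mclosed_ball y r)) ->
  open O -> no_immediate_exit P X O -> 0 < t -> bounded_measurable h -> O x ->
  {for x, continuous (killed_transition P X O t h)}.
Proof.
move=> E_proper oO A2 t0 mh Ox; have [/bounded_funE[M M0 hM] _] := mh.
have /nbhs_ballP[r /= r0 rO] : nbhs x O by apply: open_nbhs_nbhs.
pose K := mclosed_ball x (r / 2).
have KO : K `<=` O.
  move=> y /= xy; apply: rO; rewrite ballEmdist /=.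
  by apply: le_lt_trans xy _; lra.
have nK : nbhs x K.
  apply/nbhs_ballP; exists (r / 2) => /=; first by rewrite divr_gt0.
  by move=> y; rewrite ballEmdist /= => /ltW.
apply/cvgrPdist_lt => e e0.
(* Times [M] this is [e / 4]; the error occurs at both [x] and [y], which leaves [e / 2] for the
   continuity of P_s g. *)
have eM0 : 0 < e / (4 * M) by rewrite divr_gt0 ?mulr_gt0.
have /filter_ex[eta [eta0 etaK]] : \forall eta \near 0^'+, 0 < eta /\
    forall y, K y -> (P y [set w | (exit_time X O w < eta%:E)%E] < (e / (4 * M))%:E)%E.
  near=> eta; split; near: eta; first exact: nbhs_right_gt.
  exact: A2 (E_proper _ _) KO _ eM0.
(* Halving makes [s] strictly smaller than [eta] and [t], so that leaving [O] by time [s] means an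
   exit time strictly below [eta]. *)
pose s := Num.min eta t / 2.
have m0 : 0 < Num.min eta t by rewrite lt_min eta0.
have s0 : 0 < s by rewrite divr_gt0.
have sm : s < Num.min eta t by rewrite /s; lra.
have [seta st] : s < eta /\ s < t by apply/andP; rewrite -lt_min.
have [g mg gP] := killed_transition_approx X_standard X_Feller oO s0 st mh hM.
have close y : K y ->
    `|killed_transition P X O t h y - transition P X s g y| <= e / 4.
  move=> Ky; apply: le_trans (gP y) _.
  have -> : e / 4 = M * (e / (4 * M)) by field; rewrite gt_eqF.
  rewrite ler_pM2l//.
  have mS := measurable_stays X_standard X_Feller oO s0.
  rewrite -lee_fin fineK; last by rewrite fin_num_measure//; exact: measurableC.
  apply: ltW; apply: le_lt_trans (etaK y Ky); apply: le_measure; rewrite ?inE.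
  - exact: measurableC.
  - exact: (measurable_exit_time_lt X_standard X_Feller).
  - move=> w /=; rewrite -exit_time_gtE ?(ltW s0)//=;
      last exact: path_right_continuous X_standard.
    by move/negP; rewrite -leNgt => /le_lt_trans; apply; rewrite lte_fin.
have e20 : 0 < e / 2 by rewrite divr_gt0.
have /cvgrPdist_lt/(_ _ e20) gx := @X_Feller _ _ s0 mg x.
near=> y.
have Ky : K y by near: y.
have gy : `|transition P X s g x - transition P X s g y| < e / 2 by near: y.
have := close x (nbhs_singleton nK); have := close y Ky.
move: gy; rewrite !ltr_norml !ler_norml => /andP[? ?] /andP[? ?] /andP[? ?].
by apply/andP; split; lra.
Unshelve. all: by end_near. Qed.

Lemma killed_transition_continuous_out O t h x :
  open O -> 0 < t -> bounded_measurable h -> ~ closure O x ->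
  {for x, continuous (killed_transition P X O t h)}.
Proof.
move=> oO t0 mh Ox.
have nO : nbhs x (~` closure O).
  by apply: open_nbhs_nbhs; split=> //; apply: closed_openC; exact: closed_closure.
apply: cvg_near_cst; apply: filterS nO => y Oy.
by rewrite !killed_transition_out// => /subset_closure.
Qed.

(** The value at [y] is 0 since an open set misses its boundary. Nearby points outside [O] also give
    0, and at those in [O] the bound is [M] times the probability of surviving past [t], which (A4)
    with eta = t sends to 0. *)
Lemma killed_transition_continuous_boundary O t h y :
  open O -> regular_boundary P X O -> 0 < t -> bounded_measurable h ->
  boundary O y -> {for y, continuous (killed_transition P X O t h)}.
Proof.
move=> oO A4 t0 mh yO; have [/bounded_funE[M M0 hM] _] := mh.
have Oy : ~ O y by move: (yO) => [_]; rewrite (interior_id _).1.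
apply/cvgrPdist_lt => e e0; rewrite (killed_transition_out oO t0 mh Oy).
have exit_y : fine (P x [set w | (t%:E < exit_time X O w)%E])
    @[x --> within O (nbhs y)] --> (0 : R) by apply: fine_cvg; exact: A4.
move/cvgrPdist_lt: exit_y => /(_ _ (divr_gt0 e0 M0)).
rewrite near_withinE; apply: filterS => x xO; rewrite sub0r normrN.
have [Ox|Ox] := pselect (O x); last by rewrite killed_transition_out// normr0.
apply: le_lt_trans (killed_transition_le _ oO t0 mh hM) _.
rewrite -ltr_pdivlMl// mulrC; apply: le_lt_trans (xO Ox).
by rewrite /= sub0r normrN ler_norm.
Qed.

End continuity.

Theorem proposition3 (R : realType) (E : pointedMetricType R)
    (d : measure_display) (Omega : measurableType d)
    (P : E -> probability Omega R) (X : R -> Omega -> E)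
    (F : R -> set (set Omega)) (O : set E)
    (E_locally_compact : locally_compact [set: E])
    (E_separable : separable E)
    (E_proper : forall (x : E) (r : R), compact (mclosed_ball x r))
    (X_standard : standard_process P X F)
    (X_weakly_Feller : weakly_Feller P X)
    (O_open : open O)
    (A2 : no_immediate_exit P X O)
    (A3 : strongly_Feller P X) :
  (forall (t : R) (h : E -> R), 0 < t -> bounded_measurable h ->
     {within ~` boundary O, continuous (killed_transition P X O t h)}) /\
  (regular_boundary P X O ->
     (forall (t : R) (h : E -> R), 0 < t -> bounded_measurable h ->
        bounded_continuous (killed_transition P X O t h)) /\
     (forall (t : R) (h : E -> R), 0 < t -> bounded_continuous h ->
        bounded_continuous (killed_transition P X O t h))).
Proof.
(* A point off the boundary is either in [O] or outside its closure. *)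
have off_boundary t h x : 0 < t -> bounded_measurable h -> ~ boundary O x ->
    {for x, continuous (killed_transition P X O t h)}.
  move=> t0 mh xO; have [Ox|Ox] := pselect (O x).
    exact: (killed_transition_continuous_in X_standard).
  apply: (killed_transition_continuous_out X_standard) => // Ox'.
  by apply: xO; split=> // /interior_subset.
split=> [t h t0 mh|A4].
  apply: continuous_in_subspaceT => x; rewrite inE => xO.
  exact: off_boundary.
have main t h : 0 < t -> bounded_measurable h ->
    bounded_continuous (killed_transition P X O t h).
  move=> t0 mh; split; first exact: (killed_transition_bounded X_standard).
  move=> x; have [xO|] := pselect (boundary O x); last exact: off_boundary.
  exact: (killed_transition_continuous_boundary X_standard).
split=> // t h t0 [bh ch]; apply: main => //; split=> //.
exact: borel_continuous.
Qed.
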